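(* Let $\lambda$ be a Borel measure on $\mathbb{R}^d$, let $\emptyset\neq\Omega\subset\mathbb{R}^d$ be open with $\lambda(\Omega)<\infty$, and let $K\in\mathcal{K}$ be $\lambda$-symmetric. If $u\in V$ satisfies $$\int_\Omega\Big(\int_{\mathbb{R}^d}|u(x)-u(y)|\,K(x,\mathrm{d}y)\Big)^2\,\mathrm{d}\lambda(x)<\infty,$$ then for all $v\in V$ $$\int_\Omega\mathcal{L}u(x)\,v(x)\,\mathrm{d}\lambda(x)=\mathcal{B}(u,v)-\int_\Gamma\mathcal{N}u(y)\,v(y)\,\mathrm{d}\lambda(y).$$ In particular (taking $v=\chi_{\mathbb{R}^d}$), $\int_\Omega-\mathcal{L}u(x)\,\mathrm{d}\lambda(x)=\int_\Gamma\mathcal{N}u(y)\,\mathrm{d}\lambda(y)$.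
   Context: A transition kernel is a map $K:\mathbb{R}^d\times\mathcal{B}(\mathbb{R}^d)\to[0,\infty]$ ($\mathcal{B}(\mathbb{R}^d)$ the Borel $\sigma$-algebra) such that $K(x,\cdot)$ is a $\sigma$-finite measure for every $x$ and $K(\cdot,A)$ is Borel measurable for every $A$. It is non-degenerated if $x\mapsto\int f(x,y)\,K(x,\mathrm{d}y)$ is Borel measurable for every non-negative Borel measurable $f:\mathbb{R}^d\times\mathbb{R}^d\to\mathbb{R}$; $\mathcal{K}$ is the set of non-degenerated transition kernels. For a Borel measure $\lambda$, $K\in\mathcal{K}$ is $\lambda$-symmetric if $\lambda\otimes K=K\otimes\lambda$, where $(\lambda\otimes K)(M)=\int\int\chi_M(x,y)\,K(x,\mathrm{d}y)\,\mathrm{d}\lambda(x)$ and $(K\otimes\lambda)(M)=\int\int\chi_M(x,y)\,K(y,\mathrm{d}x)\,\mathrm{d}\lambda(y)$. The nonlocal boundary of $\Omega$ is $\Gamma=\{y\in\mathbb{R}^d\setminus\Omega: K(y,\Omega)>0\}$. The operators are $$\mathcal{L}u(x)=\operatorname{PV}\int_{\mathbb{R}^d}(u(x)-u(y))\,K(x,\mathrm{d}y),\qquad \mathcal{N}u(y)=\int_\Omega(u(y)-u(x))\,K(y,\mathrm{d}x)\ \ (y\in\Gamma);$$ the principal value is the ordinary Lebesgue integral whenever the integrand is $K(x,\cdot)$-integrable (as is the case for $\lambda$-a.e. $x\in\Omega$ under the displayed regularity condition on $u$). $\mathcal{V}$ is the space of Borel measurable $v:\mathbb{R}^d\to\mathbb{R}$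 with $\|v\|_{\mathcal{V}}^2=\int_\Omega v(x)^2\,\mathrm{d}\lambda(x)+\int_\Omega\int_{\mathbb{R}^d}(v(x)-v(y))^2\,K(x,\mathrm{d}y)\,\mathrm{d}\lambda(x)<\infty$. $V=\mathcal{V}/\ker\|\cdot\|_{\mathcal{V}}$, where $\ker\|\cdot\|_{\mathcal{V}}$ consists of the $v\in\mathcal{V}$ vanishing $\lambda$-a.e. on $\Omega\cup\Gamma$; elements of $V$ are treated as functions defined $\lambda$-a.e. on $\Omega\cup\Gamma$. The bilinear form on $V$ is $$\mathcal{B}(u,v)=\tfrac12\int_\Omega\int_\Omega(u(x)-u(y))(v(x)-v(y))\,K(x,\mathrm{d}y)\,\mathrm{d}\lambda(x)+\int_\Omega\int_{\mathbb{R}^d\setminus\Omega}(u(x)-u(y))(v(x)-v(y))\,K(x,\mathrm{d}y)\,\mathrm{d}\lambda(x).$$ *)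

(* Defs.v *)
From mathcomp Require Import all_boot all_order all_algebra.
From mathcomp Require Import all_classical all_reals all_analysis.
From mathcomp Require Import measurable_realfun.

Set Implicit Arguments.
Unset Strict Implicit.
Unset Printing Implicit Defensive.

Import Order.TTheory GRing.Theory Num.Theory.
Import numFieldNormedType.Exports.

Local Open Scope classical_set_scope.
Local Open Scope ring_scope.
Local Open Scope ereal_scope.

(* R^d with its Borel sigma-algebra, generated by the open sets of the product
   topology.  On [borelRn R d * borelRn R d] the library's product
   sigma-algebra is the Borel sigma-algebra of R^d x R^d, R^d being second
   countable. *)
Definition borelRn (R : realType) (d : nat) :=
  g_sigma_algebraType (@open 'rV[R]_d).

(* The norm that 'rV[R]_d carries in the library is the sup norm. *)
Definition eucl_dist (R : realType) (d : nat) (x y : 'rV[R]_d) : R :=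
  Num.sqrt (\sum_(i < d) (x ord0 i - y ord0 i) ^+ 2)%R.

Definition nondegenerated (R : realType) (d : nat)
    (K : R.-sigmafker borelRn R d ~> borelRn R d) : Prop :=
  forall f : borelRn R d * borelRn R d -> R,
    measurable_fun [set: borelRn R d * borelRn R d] f ->
    (forall z, (0 <= f z)%R) ->
    measurable_fun [set: borelRn R d]
      (fun x => \int[K x]_y (f (x, y))%:E).

Definition ksymmetric (R : realType) (d : nat)
    (lambda : {measure set (borelRn R d) -> \bar R})
    (K : R.-sigmafker borelRn R d ~> borelRn R d) : Prop :=
  forall M : set (borelRn R d * borelRn R d), measurable M ->
    \int[lambda]_x \int[K x]_y (\1_M (x, y))%:E =
    \int[lambda]_y \int[K y]_x (\1_M (x, y))%:E.

Definition nlboundary (R : realType) (d : nat)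
    (K : R.-sigmafker borelRn R d ~> borelRn R d) (Omega : set 'rV[R]_d) :
    set 'rV[R]_d :=
  [set y | ~ Omega y /\ 0 < K y Omega].

(* If f is mu-integrable and f x = 0, this limit is the Lebesgue integral of
   f, by dominated convergence. *)
Definition pv_integral (R : realType) (d : nat)
    (mu : {measure set (borelRn R d) -> \bar R}) (x : 'rV[R]_d)
    (f : 'rV[R]_d -> R) : \bar R :=
  lim ((\int[mu]_(y in [set y | (eps <= eucl_dist x y)%R]) (f y)%:E)
         @[eps --> (0:R)%R^'+]).

Definition opL (R : realType) (d : nat)
    (K : R.-sigmafker borelRn R d ~> borelRn R d) (u : 'rV[R]_d -> R)
    (x : 'rV[R]_d) : \bar R :=
  pv_integral (K x) x (fun y => u x - u y)%R.

Definition opN (R : realType) (d : nat)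
    (K : R.-sigmafker borelRn R d ~> borelRn R d) (Omega : set 'rV[R]_d)
    (u : 'rV[R]_d -> R) (y : 'rV[R]_d) : \bar R :=
  \int[K y]_(x in Omega) (u y - u x)%:E.

Definition sqnormV (R : realType) (d : nat)
    (lambda : {measure set (borelRn R d) -> \bar R})
    (K : R.-sigmafker borelRn R d ~> borelRn R d) (Omega : set 'rV[R]_d)
    (v : 'rV[R]_d -> R) : \bar R :=
  \int[lambda]_(x in Omega) (v x ^+ 2)%:E +
  \int[lambda]_(x in Omega) \int[K x]_y ((v x - v y) ^+ 2)%:E.

(* The functions representing the elements of V = calV / ker. *)
Definition calV (R : realType) (d : nat)
    (lambda : {measure set (borelRn R d) -> \bar R})
    (K : R.-sigmafker borelRn R d ~> borelRn R d) (Omega : set 'rV[R]_d) :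
    set ('rV[R]_d -> R) :=
  [set v | measurable_fun [set: borelRn R d] (v : borelRn R d -> R) /\
           sqnormV lambda K Omega v < +oo].

Definition bformB (R : realType) (d : nat)
    (lambda : {measure set (borelRn R d) -> \bar R})
    (K : R.-sigmafker borelRn R d ~> borelRn R d) (Omega : set 'rV[R]_d)
    (u v : 'rV[R]_d -> R) : \bar R :=
  (2^-1)%:E * \int[lambda]_(x in Omega) \int[K x]_(y in Omega)
                ((u x - u y) * (v x - v y))%:E +
  \int[lambda]_(x in Omega) \int[K x]_(y in ~` Omega)
                ((u x - u y) * (v x - v y))%:E.

(* Main.v *)
Require Import Defs.
From HB Require Import structures.
From mathcomp Require Import all_boot all_order all_algebra.
From mathcomp Require Import all_classical all_reals all_analysis.
From mathcomp Require Import measurable_realfun unstable ring lra.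
Import Order.TTheory GRing.Theory Num.Theory.
Import numFieldNormedType.Exports.
Local Open Scope classical_set_scope.
Local Open Scope ring_scope.
Local Open Scope ereal_scope.

Set Implicit Arguments.
Unset Strict Implicit.
Unset Printing Implicit Defensive.

(** Green's formula says that one and the same double integral can be read in
    two ways. Let [m = lambda (x) K], the measure [K(x, dy) lambda(dx)] on pairs
    of points; symmetry of [K] means exactly that [m] is invariant under
    exchanging the two points ([comp_prod_symmetric]). Put
      [F1 (x, y) = (u x - u y) v x]  and  [F2 (x, y) = (u x - u y) v y]
    ([flux_source] and [flux_target] below), so that [F2 = - F1 \o swap], and
    [F1 - F2] is the integrand of the bilinear form. Write [Om'] for the
    complement of [Omega]. Then:
    - [\int_Omega (L u) v dlambda] is the integral of [F1] over
      [Omega x R^d], hence over [Omega x Omega] plus [Omega x Om'];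
    - on [Omega x Omega], which is invariant under the exchange, the integral
      of [F2] is minus that of [F1], so half the integral of [F1 - F2] is the
      integral of [F1];
    - on [Omega x Om'], [F1 = (F1 - F2) + F2], and exchanging the points turns
      the integral of [F2] into minus the integral of [(N u) v] over [Om'],
      where only the nonlocal boundary contributes.
    Adding up gives the formula; its last assertion is the case [v = 1], for
    which the bilinear form vanishes.

    All the splittings are legitimate because [F1] and [F2] are [m]-integrable
    on [Omega x R^d]. With [G x = \int |u x - u y| K(x, dy)], integrating [|F1|]
    in [y] gives [G x * |v x| <= (G x)^2 + (v x)^2], which is integrable by the
    regularity of [u] and [v \in L^2(Omega)]; and [|F1 - F2|] is at most
    [(u x - u y)^2 + (v x - v y)^2], which is controlled by the norms of [u] and
    [v] ([integrable_flux_source], [integrable_energy_density]).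

    Two points need care. First, [lambda] is an arbitrary Borel measure and the
    [K x] are sigma-finite with no uniform bound, so [m] and its Fubini theorem
    are built directly from the measurability of [x |-> K x (M x)], [M x] the
    section of [M], which is what non-degeneracy provides. Secondly, the
    principal value is identified with the Lebesgue integral only where
    [u x - u y] is [K x]-integrable, i.e. off a null set of [x], and nothing is
    known about the measurability of [L u] on that null set;
    [integral_eq_off_null] therefore compares the integrals of arbitrary
    functions. *)

(** * The composition product of a measure and a kernel *)

Section composition_product.
Context d1 d2 (T1 : measurableType d1) (T2 : measurableType d2) (R : realType).
Variables (mu : {measure set T1 -> \bar R}) (k : T1 -> {measure set T2 -> \bar R}).
Hypothesis mk : forall M : set (T1 * T2), measurable M ->
  measurable_fun [set: T1] (fun x => k x (xsection M x)).

(** The measure usually written [mu (x) k]. Measurability of [k] on the sections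
    of measurable sets stands in for the usual finiteness assumptions. *)
Definition comp_prod (M : set (T1 * T2)) : \bar R :=
  \int[mu]_x k x (xsection M x).

Let comp_prod0 : comp_prod set0 = 0.
Proof. by apply: integral0_eq => x _; rewrite xsection0 measure0. Qed.

Let comp_prod_ge0 M : 0 <= comp_prod M.
Proof. by apply: integral_ge0 => x _; exact: measure_ge0. Qed.

Let comp_prod_additive : semi_sigma_additive comp_prod.
Proof.
move=> F mF tF _; rewrite [X in _ --> X](_ : _ =
    \int[mu]_x \sum_(0 <= n <oo) k x (xsection (F n) x)); last first.
  apply: eq_integral => x _; rewrite xsection_bigcup; apply/esym/cvg_lim => //.
  apply: measure_sigma_additive => [n|]; first exact: measurable_xsection.
  exact: trivIset_xsection.
rewrite [X in X @ _](_ : _ = (fun n =>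
    \int[mu]_x \sum_(0 <= i < n) k x (xsection (F i) x))); last first.
  by apply/funext => n; rewrite -ge0_integral_sum// => i; exact: mk.
apply: cvg_monotone_convergence => //.
- by move=> n; apply: emeasurable_sum => i; exact: mk.
- by move=> n x _; rewrite sume_ge0.
- by move=> x _ m n mn; exact: ereal_nondecreasing_series.
Qed.

HB.instance Definition _ := isMeasure.Build _ _ _ comp_prod
  comp_prod0 comp_prod_ge0 comp_prod_additive.

Definition comp_prod_measure : {measure set (T1 * T2) -> \bar R} := comp_prod.

End composition_product.

Section composition_product_fubini.
Context d1 d2 (T1 : measurableType d1) (T2 : measurableType d2) (R : realType).
Variables (mu : {measure set T1 -> \bar R}) (k : T1 -> {measure set T2 -> \bar R}).
Hypothesis mk : forall M : set (T1 * T2), measurable M ->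
  measurable_fun [set: T1] (fun x => k x (xsection M x)).

Let m := comp_prod_measure mu mk.

Import HBNNSimple.

(** A simple function is integrated against [k x] level set by level set, which
    brings everything back to the sections in [mk]. *)
Lemma sintegral_xsection (h : {nnsfun T1 * T2 >-> R}) x :
  \int[k x]_y (h (x, y))%:E =
  \sum_(r \in range h) r%:E * k x (xsection (h @^-1` [set r]) x).
Proof.
under eq_integral => y _.
  rewrite fimfunE -fsumEFin//.
  over.
rewrite ge0_integral_fsum//; last 2 first.
- move=> r; apply/measurable_EFinP; apply: measurable_funM => //.
  by apply: measurableT_comp.
- by move=> r y _; rewrite EFinM nnfun_muleindic_ge0.
apply: eq_fsbigr => r _.
have mr : measurable (xsection (h @^-1` [set r]) x).
  apply: measurable_xsection; rewrite -[X in measurable X]setTI.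
  exact: measurable_funP.
have := @integralZl_indic _ _ _ (k x) _ measurableT
  (fun r => xsection (h @^-1` [set r]) x) r.
rewrite [X in _ -> _ -> _ = _ * X]integral_indic// setIT => <- //.
- by apply: eq_integral => y _; rewrite !indicE/= mem_xsection.
- by move=> r0; rewrite preimage_nnfun0 ?xsection0.
Qed.

Lemma measurable_sintegral_xsection (h : {nnsfun T1 * T2 >-> R}) :
  measurable_fun [set: T1] (fun x => \int[k x]_y (h (x, y))%:E).
Proof.
under eq_fun do rewrite sintegral_xsection.
apply: emeasurable_fsum => // r; apply: measurable_funeM; apply: mk.
by rewrite -[X in measurable X]setTI; exact: measurable_funP.
Qed.

Lemma ge0_integral_comp_prod_nnsfun (h : {nnsfun T1 * T2 >-> R}) :
  \int[m]_z (h z)%:E = \int[mu]_x \int[k x]_y (h (x, y))%:E.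
Proof.
have mh r : measurable (h @^-1` [set r]).
  by rewrite -[X in measurable X]setTI; exact: measurable_funP.
rewrite integralT_nnsfun sintegralE.
under [RHS]eq_integral do rewrite sintegral_xsection.
rewrite ge0_integral_fsum//; last 2 first.
- by move=> r; apply: measurable_funeM; exact: mk.
- by move=> r x _; have [r0|r0] := ltP r 0%R;
    [rewrite preimage_nnfun0// xsection0 measure0 mule0|rewrite mule_ge0].
apply: eq_fsbigr => r _; have [r0|r0] := ltP r 0%R.
  rewrite preimage_nnfun0// measure0 mule0 integral0_eq// => x _.
  by rewrite xsection0 measure0 mule0.
by rewrite ge0_integralZl//; exact: mk.
Qed.

Section nonnegative.
Variable f : T1 * T2 -> \bar R.
Hypotheses (mf : measurable_fun [set: T1 * T2] f) (f0 : forall z, 0 <= f z).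

Let g := nnsfun_approx measurableT mf.

Let gE x y : (g n (x, y))%:E @[n --> \oo] --> f (x, y).
Proof. exact: (@cvg_nnsfun_approx _ _ _ _ measurableT). Qed.

Let g_nd z : {homo (fun n => (g n z)%:E) : a b / (a <= b)%N >-> a <= b}.
Proof. by move=> a b ab; rewrite lee_fin; exact/lefP/nd_nnsfun_approx. Qed.

Let mg n x : measurable_fun [set: T2] (fun y => (g n (x, y))%:E).
Proof. by apply/measurable_EFinP; apply: measurableT_comp. Qed.

Let inner_cvg x :
  \int[k x]_y (g n (x, y))%:E @[n --> \oo] --> \int[k x]_y f (x, y).
Proof.
rewrite (_ : \int[k x]_y f (x, y) =
    \int[k x]_y (limn (fun n => (g n (x, y))%:E))); last first.
  by apply: eq_integral => y _; apply/esym/cvg_lim => //; exact: gE.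
apply: cvg_monotone_convergence => //.
- by move=> n y _; rewrite lee_fin.
Qed.

(** By monotone convergence, from the simple functions below [f]. *)
Lemma measurable_ge0_integral_section :
  measurable_fun [set: T1] (fun x => \int[k x]_y f (x, y)).
Proof.
apply: (emeasurable_fun_cvg (fun n x => \int[k x]_y (g n (x, y))%:E)) => //.
by move=> n; exact: measurable_sintegral_xsection.
Qed.

(** Both sides are monotone limits along the same sequence of simple functions,
    for which they agree. *)
Lemma ge0_integral_comp_prod :
  \int[m]_z f z = \int[mu]_x \int[k x]_y f (x, y).
Proof.
have cvgm : \int[m]_z (g n z)%:E @[n --> \oo] --> \int[m]_z f z.
  rewrite (_ : \int[m]_z f z = \int[m]_z (limn (fun n => (g n z)%:E))); last first.
    by apply: eq_integral => -[x y] _; apply/esym/cvg_lim => //; exact: gE.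
  apply: cvg_monotone_convergence => //.
  - by move=> n; exact/measurable_EFinP.
  - by move=> n y _; rewrite lee_fin.
have cvgi : \int[mu]_x \int[k x]_y (g n (x, y))%:E @[n --> \oo] -->
    \int[mu]_x \int[k x]_y f (x, y).
  rewrite (_ : \int[mu]_x _ = \int[mu]_x
      (limn (fun n => \int[k x]_y (g n (x, y))%:E))); last first.
    by apply: eq_integral => x _; apply/esym/cvg_lim => //; exact: inner_cvg.
  apply: cvg_monotone_convergence => //.
  - by move=> n; exact: measurable_sintegral_xsection.
  - by move=> n x _; apply: integral_ge0 => y _; rewrite lee_fin.
  - move=> x _ a b ab; apply: ge0_le_integral => //.
    + by move=> y _; rewrite lee_fin.
    + by move=> y _; exact: g_nd.
rewrite -(cvg_lim _ cvgm)// -(cvg_lim _ cvgi)//; congr (limn _).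
by apply/funext => n; exact: ge0_integral_comp_prod_nnsfun.
Qed.

End nonnegative.

Section rectangle.
Variables (D1 : set T1) (D2 : set T2).
Hypotheses (mD1 : measurable D1) (mD2 : measurable D2).

Let mD12 : measurable (D1 `*` D2). Proof. exact: measurableX. Qed.

Lemma restrict_setX (f : T1 * T2 -> \bar R) x y :
  (f \_ (D1 `*` D2)) (x, y) =
  ((fun x => ((fun y => f (x, y)) \_ D2) y) \_ D1) x.
Proof. by rewrite !patchE in_setX /=; case: (x \in D1). Qed.

Lemma integral_restrict_setX (f : T1 * T2 -> \bar R) x :
  \int[k x]_y (f \_ (D1 `*` D2)) (x, y) =
  ((fun x => \int[k x]_(y in D2) f (x, y)) \_ D1) x.
Proof.
rewrite [RHS]patchE; case: ifPn => xD1.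
  rewrite [RHS]integral_mkcond; apply: eq_integral => y _.
  by rewrite restrict_setX patchE xD1.
by apply: integral0_eq => y _; rewrite restrict_setX patchE (negbTE xD1).
Qed.

Section ge0.
Variable f : T1 * T2 -> \bar R.
Hypotheses (mf : measurable_fun (D1 `*` D2) f).
Hypothesis f0 : forall x y, D1 x -> D2 y -> 0 <= f (x, y).

Let mf' : measurable_fun setT (f \_ (D1 `*` D2)).
Proof. exact/(measurable_restrictT _ mD12). Qed.

Let f0' z : 0 <= (f \_ (D1 `*` D2)) z.
Proof. by rewrite patchE; case: ifPn => // /[!inE]; case: z => x y [/f0]; apply. Qed.

Lemma measurable_ge0_integral_sectionX :
  measurable_fun D1 (fun x => \int[k x]_(y in D2) f (x, y)).
Proof.
apply/(measurable_restrictT _ mD1).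
apply: eq_measurable_fun (measurable_ge0_integral_section mf' f0').
by move=> x _; rewrite integral_restrict_setX.
Qed.

Lemma ge0_integral_comp_prodX :
  \int[m]_(z in D1 `*` D2) f z = \int[mu]_(x in D1) \int[k x]_(y in D2) f (x, y).
Proof.
rewrite [RHS]integral_mkcond [LHS]integral_mkcond (ge0_integral_comp_prod mf' f0').
by apply: eq_integral => x _; rewrite integral_restrict_setX.
Qed.

End ge0.

Section integrable.
Variable f : T1 * T2 -> \bar R.
Hypothesis fi : m.-integrable (D1 `*` D2) f.

Let mf : measurable_fun (D1 `*` D2) f. Proof. exact: measurable_int fi. Qed.

Let mpos : measurable_fun (D1 `*` D2) f^\+. Proof. exact: measurable_funepos. Qed.
Let mneg : measurable_fun (D1 `*` D2) f^\-. Proof. exact: measurable_funeneg. Qed.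

Let inner_pos : mu.-integrable D1 (fun x => \int[k x]_(y in D2) f^\+ (x, y)).
Proof.
apply/integrableP; split; first exact: measurable_ge0_integral_sectionX.
under eq_integral do rewrite gee0_abs ?integral_ge0//.
rewrite -ge0_integral_comp_prodX//.
exact: (integral_funepos_lt_pinfty mD12 fi).
Qed.

Let inner_neg : mu.-integrable D1 (fun x => \int[k x]_(y in D2) f^\- (x, y)).
Proof.
apply/integrableP; split; first exact: measurable_ge0_integral_sectionX.
under eq_integral do rewrite gee0_abs ?integral_ge0//.
rewrite -ge0_integral_comp_prodX//.
exact: (integral_funeneg_lt_pinfty mD12 fi).
Qed.

Let innerE x : \int[k x]_(y in D2) f (x, y) =
  \int[k x]_(y in D2) f^\+ (x, y) - \int[k x]_(y in D2) f^\- (x, y).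
Proof. by rewrite (integralE _ _ (f \o pair x)) funepos_comp funeneg_comp. Qed.

(** The integral of a section is by definition the difference of the integrals
    of its positive and negative parts, even where both are infinite; so the
    nonnegative case applies to each part, and nothing has to be said about the
    exceptional points. *)
Lemma integrable_integral_section :
  mu.-integrable D1 (fun x => \int[k x]_(y in D2) f (x, y)).
Proof. by under eq_fun do rewrite innerE; exact: integrableB. Qed.

Lemma integral_comp_prodX :
  \int[m]_(z in D1 `*` D2) f z = \int[mu]_(x in D1) \int[k x]_(y in D2) f (x, y).
Proof.
under [RHS]eq_integral do rewrite innerE.
by rewrite [RHS]integralB// [LHS]integralE !ge0_integral_comp_prodX.
Qed.

(** An integrable function is finite almost everywhere; this is applied to
    [x |-> \int |f (x, y)| k(x, dy)]. *)
Lemma integrable_section_off_null : exists N, [/\ measurable N, mu N = 0 &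
  forall x, D1 x -> ~ N x -> (k x).-integrable D2 (fun y => f (x, y))].
Proof.
have mabs : measurable_fun (D1 `*` D2) (fun z => `|f z|) by exact: measurableT_comp.
have : mu.-integrable D1 (fun x => \int[k x]_(y in D2) `|f (x, y)|).
  apply/integrableP; split.
    by apply: (measurable_ge0_integral_sectionX mabs) => x y _ _.
  under eq_integral do rewrite gee0_abs ?integral_ge0//.
  rewrite -(ge0_integral_comp_prodX mabs)//.
  by case/integrableP : fi.
move=> /(integrable_ae mD1) [N [mN N0 subN]]; exists N; split => // x D1x Nx.
apply/integrableP; split.
  apply/(measurable_restrictT _ mD2).
  apply: (@eq_measurable_fun _ _ _ _ _ (fun y => (f \_ (D1 `*` D2)) (x, y))).
    by move=> y _; rewrite restrict_setX [LHS]patchE mem_set.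
  by apply: measurableT_comp => //; exact/(measurable_restrictT _ mD12).
have := @contra_notP _ _ (@subN x) Nx => /(_ D1x).
by rewrite ge0_fin_numE// integral_ge0.
Qed.

End integrable.

End rectangle.

End composition_product_fubini.

(** * Integrals that agree off a null set *)

Section integral_off_null.
Context d (T : measurableType d) (R : realType).
Variable mu : {measure set T -> \bar R}.

Import HBNNSimple.

(** The integral is a supremum over the simple functions below the integrand;
   cutting such a function off on [N] does not change its integral and puts it
   below [g]. *)
Let le_ge0_integral_off_null (N : set T) (f g : T -> \bar R) :
  measurable N -> mu N = 0 -> (forall x, 0 <= f x) -> (forall x, 0 <= g x) ->
  (forall x, ~ N x -> f x = g x) -> \int[mu]_x f x <= \int[mu]_x g x.
Proof.
move=> mN N0 f0 g0 fg; rewrite !ge0_integralTE//.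
apply: ge_ereal_sup => _ [h /= hf <-].
pose h' := proj_nnsfun h (measurableC mN).
have h'E x : h' x = (h \_ (~` N)) x by rewrite (mrestrict h (measurableC mN)).
have -> : sintegral mu h = sintegral mu h'.
  rewrite -!integralT_nnsfun; apply: ge0_ae_eq_integral => //.
  - exact/measurable_EFinP.
  - exact/measurable_EFinP.
  - by move=> x _; rewrite lee_fin.
  - by move=> x _; rewrite lee_fin.
  - exists N; split => // x /= hx; apply: contrapT => Nx; apply: hx => _.
    by rewrite -[X in _ = X%:E]/(h' x) h'E patchE mem_set.
apply: ereal_sup_ubound; exists h' => //= x.
rewrite -[X in X%:E]/(h' x) h'E patchE; case: ifPn => [/[!inE] Nx|_]; last exact: g0.
by rewrite -fg.
Qed.

(** Stated for arbitrary [f] and [g] because it is used with a principal value,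
    which may fail to be measurable on [N]. *)
Lemma integral_eq_off_null (D N : set T) (f g : T -> \bar R) :
  measurable N -> mu N = 0 -> (forall x, D x -> ~ N x -> f x = g x) ->
  \int[mu]_(x in D) f x = \int[mu]_(x in D) g x.
Proof.
move=> mN N0 fg.
have fgD x : ~ N x -> (f \_ D) x = (g \_ D) x.
  by move=> Nx; rewrite !patchE; case: ifPn => // /[!inE] Dx; exact: fg.
rewrite integral_mkcond [RHS]integral_mkcond [LHS]integralE [RHS]integralE.
by congr (_ - _); apply/eqP; rewrite eq_le; apply/andP; split;
  apply: (le_ge0_integral_off_null mN) => // x Nx;
  rewrite ?funeposE ?funenegE fgD.
Qed.

End integral_off_null.

(** * The principal value of an integrable function *)

Section principal_value.
Context (R : realType) (d : nat).
Implicit Types x y : 'rV[R]_d.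

Lemma eucl_dist_continuous x : continuous (eucl_dist x).
Proof.
move=> y; rewrite /eucl_dist.
apply: (@continuous_comp _ _ _ (fun y : 'rV[R]_d =>
  \sum_(i < d) (x ord0 i - y ord0 i) ^+ 2)%R Num.sqrt); last first.
  exact: sqrt_continuous.
apply: (@continuous_big _ _ +%R) => [|i _ {}y]; first exact: (@add_continuous R^o).
apply: (@continuous_comp _ _ _ (fun y : 'rV[R]_d => x ord0 i - y ord0 i)%R
  (fun r : R => r ^+ 2)%R).
  apply: (@continuousB _ _ _ (fun=> x ord0 i) (fun y : 'rV[R]_d => y ord0 i)).
    exact: cst_continuous.
  exact: coord_continuous.
exact: exprn_continuous.
Qed.

Lemma eucl_dist_eq0 x y : eucl_dist x y = 0%R -> x = y.
Proof.
move=> /eqP; rewrite sqrtr_eq0 => s0; apply/rowP => i.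
have : (\sum_(i < d) (x ord0 i - y ord0 i) ^+ 2)%R == 0%R.
  by rewrite eq_le s0 sumr_ge0// => j _; rewrite sqr_ge0.
rewrite psumr_eq0; last by move=> j _; rewrite sqr_ge0.
by move=> /allP/(_ i (mem_index_enum _)); rewrite sqrf_eq0 subr_eq0 => /eqP.
Qed.

(** The truncated integrands converge pointwise to [f], at the centre [x]
    because [f x = 0], and are dominated by [|f|]. *)
Lemma pv_integralE (mu : {measure set (borelRn R d) -> \bar R}) x
    (f : 'rV[R]_d -> R) :
  f x = 0%R -> mu.-integrable [set: borelRn R d] (EFin \o f) ->
  pv_integral mu x f = \int[mu]_y (f y)%:E.
Proof.
move=> fx0 fi.
have mball e : measurable ([set y | (e <= eucl_dist x y)%R] : set (borelRn R d)).
  rewrite -[X in measurable X]setCK; apply: measurableC; apply: sub_sigma_algebra.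
  rewrite (_ : ~` _ = eucl_dist x @^-1` [set r | (r < e)%R]).
    by apply: open_comp; [move=> y _; exact: eucl_dist_continuous|exact: open_lt].
  by apply/seteqP; split => y /=; [move/negP; rewrite -ltNge|rewrite ltNge => /negP].
have mf := measurable_int _ fi.
pose F e := \int[mu]_(y in [set y | (e <= eucl_dist x y)%R]) (f y)%:E.
have Ffin e : F e \is a fin_num.
  by apply: integrable_fin_num => //; exact: integrableS fi.
apply: cvg_lim => //.
rewrite -(fineK (integrable_fin_num measurableT fi)).
apply/cvg_EFin; first by near=> e; exact: Ffin.
(* Dominated convergence is about sequences, so the limit along the filter at
   [0^'+] is tested on sequences [e n] tending to [0] from the right. *)
apply/cvg_at_rightP => e [e0 e_cvg].
apply: fine_cvg; rewrite fineK ?(integrable_fin_num measurableT fi)//.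
pose f_ n := (EFin \o f) \_ [set y | (e n <= eucl_dist x y)%R].
have [] := @dominated_convergence _ _ _ mu _ measurableT
  f_ (EFin \o f) (abse \o (EFin \o f)).
- by move=> n; apply/(measurable_restrictT _ (mball _)); exact: measurable_funS mf.
- exact: mf.
- apply: aeW => y _; have [xy|xy] := eqVneq (eucl_dist x y) 0%R.
    rewrite (_ : f_ ^~ y = cst ((EFin \o f) y)); first exact: cvg_cst.
    apply/funext => n; rewrite /f_ patchE; case: ifPn => //= _.
    by rewrite -(eucl_dist_eq0 xy) fx0.
  have dpos : (0 < eucl_dist x y)%R by rewrite lt0r xy sqrtr_ge0.
  apply: cvg_near_cst; near=> n.
  rewrite /f_ patchE mem_set//= ltW//.
  by near: n; move/cvgr_lt : e_cvg; exact.
- exact: integrable_abse.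
- by apply: aeW => y n _; rewrite /f_ patchE; case: ifPn => //= _; rewrite normr0 lee_fin.
move=> _ _; rewrite (_ : [sequence _]_n = F \o e); first exact.
by apply/funext => n; rewrite /= /F [RHS]integral_mkcond.
Unshelve. all: by end_near. Qed.

End principal_value.

(** * Exchanging the two variables of a symmetric measure *)

Section symmetric_measure.
Context d (T : measurableType d) (R : realType).
Variable m : {measure set (T * T) -> \bar R}.
Hypothesis m_sym : forall M, measurable M -> m (swap @^-1` M) = m M.
Variables (D1 D2 : set T).
Hypotheses (mD1 : measurable D1) (mD2 : measurable D2).

Let mswap : measurable_fun setT (@swap T T) := @measurable_swap _ _ T T.

Let swap_setX : @swap T T @^-1` (D1 `*` D2) = D2 `*` D1.
Proof. by apply/seteqP; split => -[x y] [? ?]; split. Qed.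

Let mD12 : measurable (D1 `*` D2). Proof. exact: measurableX. Qed.

Lemma integrable_swap (f : T * T -> \bar R) : measurable_fun setT f ->
  m.-integrable (D1 `*` D2) f -> m.-integrable (D2 `*` D1) (f \o swap).
Proof.
move=> mf /integrableP[_ foo]; apply/integrableP; split.
  by apply: measurable_funTS; apply: measurableT_comp.
rewrite -swap_setX -(ge0_integral_pushforward mswap m (f := abse \o f))//.
- rewrite (eq_measure_integral m)// => A mA _; exact: m_sym.
- by apply: measurable_funTS; exact: measurableT_comp.
- by move=> z _; exact: abse_ge0.
Qed.

Lemma integral_swap (f : T * T -> \bar R) : measurable_fun setT f ->
  m.-integrable (D1 `*` D2) f ->
  \int[m]_(z in D1 `*` D2) f z = \int[m]_(z in D2 `*` D1) f (swap z).
Proof.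
move=> mf fi; rewrite -swap_setX -(integral_pushforward mswap)//; last first.
  by rewrite swap_setX; exact: integrable_swap.
by apply/esym/eq_measure_integral => A mA _; exact: m_sym.
Qed.

End symmetric_measure.

(** * The nonlocal Green formula *)

Lemma ge0_mule_le_sqrD (R : realType) (a : \bar R) (b : R) :
  0 <= a -> (0 <= b)%R -> a * b%:E <= a ^+ 2 + (b ^+ 2)%:E.
Proof.
move: a => [a||//] a0 b0; last by rewrite expe2 mulyy addye// leey.
rewrite lee_fin in a0.
by rewrite -EFin_expe -EFinM -EFinD lee_fin; have := sqr_ge0 (a - b); nra.
Qed.

Lemma norm_mul_le_sqrD (R : realType) (a b : R) :
  (`|a * b| <= a ^+ 2 + b ^+ 2)%R.
Proof.
rewrite normrM -(real_normK (num_real a)) -(real_normK (num_real b)).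
have := sqr_ge0 (`|a| - `|b|)%R; have := normr_ge0 a; have := normr_ge0 b.
by move=> *; nra.
Qed.

(** Think of [u z.1 - u z.2] as the flux from [z.1] to [z.2]. It is tested
    against [v] at its source, at its target, and against the difference of the
    two values, which gives the integrand of the bilinear form. *)
Definition flux_source (R : realType) d (u v : 'rV[R]_d -> R)
    (z : borelRn R d * borelRn R d) : \bar R :=
  ((u z.1 - u z.2) * v z.1)%:E.

Definition flux_target (R : realType) d (u v : 'rV[R]_d -> R)
    (z : borelRn R d * borelRn R d) : \bar R :=
  ((u z.1 - u z.2) * v z.2)%:E.

Definition energy_density (R : realType) d (u v : 'rV[R]_d -> R)
    (z : borelRn R d * borelRn R d) : \bar R :=
  ((u z.1 - u z.2) * (v z.1 - v z.2))%:E.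

Section nonlocal_green.
Context (R : realType) (d : nat).
Variables (lambda : {measure set (borelRn R d) -> \bar R}) (Omega : set 'rV[R]_d).
Hypotheses (Omega_open : open Omega) (Omega_fin : lambda Omega < +oo).
Variable K : R.-sigmafker borelRn R d ~> borelRn R d.
Hypotheses (Knd : nondegenerated K) (Ksym : ksymmetric lambda K).

Local Notation X := (borelRn R d).

Let mOm : measurable (Omega : set X). Proof. exact: sub_sigma_algebra. Qed.

Let mOmC : measurable (~` Omega : set X). Proof. exact: measurableC. Qed.

Let integral_indic_section (M : set (X * X)) x : measurable M ->
  \int[K x]_y (\1_M (x, y))%:E = K x (xsection M x).
Proof.
move=> mM; rewrite -[X in _ = K x X]setIT -[RHS]integral_indic//; last first.
  exact: measurable_xsection.
by apply: eq_integral => y _; rewrite !indicE mem_xsection.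
Qed.

(** Non-degeneracy, applied to the indicator function of [M]. *)
Lemma measurable_nondegenerated_xsection (M : set (X * X)) :
  measurable M -> measurable_fun [set: X] (fun x => K x (xsection M x)).
Proof.
move=> mM; have mI : measurable_fun setT (\1_M : X * X -> R) by [].
apply: eq_measurable_fun (Knd mI _) => // x _.
by rewrite integral_indic_section.
Qed.

Let m : {measure set (X * X) -> \bar R} :=
  comp_prod_measure lambda measurable_nondegenerated_xsection.

Lemma comp_prod_symmetric (M : set (X * X)) : measurable M ->
  m (swap @^-1` M) = m M.
Proof.
move=> mM; have mM' : measurable (swap @^-1` M).
  by rewrite -[X in measurable X]setTI; exact: measurable_swap.
transitivity (\int[lambda]_y \int[K y]_x (\1_M (x, y))%:E).
  apply: eq_integral => y _; rewrite -integral_indic_section//.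
rewrite -Ksym//; apply: eq_integral => x _.
by rewrite integral_indic_section.
Qed.

Let S : set (X * X) := Omega `*` setT.

Let mS : measurable S. Proof. exact: measurableX. Qed.

Lemma calV_measurable v : calV lambda K Omega v ->
  measurable_fun [set: X] (v : X -> R).
Proof. by case. Qed.

Lemma measurable_difference (v : X -> R) : measurable_fun [set: X] v ->
  measurable_fun [set: X * X] (fun z => v z.1 - v z.2)%R.
Proof.
move=> mv; apply: measurable_funB; exact: measurableT_comp.
Qed.

Lemma sqnormV_parts v : calV lambda K Omega v ->
  \int[lambda]_(x in Omega) (v x ^+ 2)%:E < +oo /\
  \int[lambda]_(x in Omega) \int[K x]_y ((v x - v y) ^+ 2)%:E < +oo.
Proof.
case=> _; have a0 : 0 <= \int[lambda]_(x in Omega) (v x ^+ 2)%:E.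
  by apply: integral_ge0 => x _; rewrite lee_fin sqr_ge0.
have b0 : 0 <= \int[lambda]_(x in Omega) \int[K x]_y ((v x - v y) ^+ 2)%:E.
  by apply: integral_ge0 => x _; apply: integral_ge0 => y _; rewrite lee_fin sqr_ge0.
by move=> vfin; split; apply: le_lt_trans vfin; rewrite /sqnormV ?leeDl ?leeDr.
Qed.

Lemma integrable_sqr_difference v : calV lambda K Omega v ->
  m.-integrable S (fun z => ((v z.1 - v z.2) ^+ 2)%:E).
Proof.
move=> Vv; have mv := calV_measurable Vv; have [_ vfin] := sqnormV_parts Vv.
have mF : measurable_fun setT (fun z : X * X => ((v z.1 - v z.2) ^+ 2)%:E).
  by apply/measurable_EFinP; apply: measurable_funX; exact: measurable_difference.
apply/integrableP; split; first exact: measurable_funTS.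
under eq_integral do rewrite gee0_abs ?lee_fin ?sqr_ge0//.
rewrite ge0_integral_comp_prodX//; first exact: measurable_funTS.
by move=> x y _ _; rewrite lee_fin sqr_ge0.
Qed.

Lemma calV_cst1 : calV lambda K Omega (cst 1%R).
Proof.
split; first exact: measurable_cst.
rewrite /sqnormV [X in _ + X]integral0_eq; last first.
  by move=> x _; apply: integral0_eq => y _; rewrite subrr expr0n.
by rewrite adde0 /= expr1n integral_cst// mul1e.
Qed.

Variable u : 'rV[R]_d -> R.
Hypothesis Vu : calV lambda K Omega u.
Hypothesis u_reg : \int[lambda]_(x in Omega)
  ((\int[K x]_y (`|u x - u y|%R)%:E) ^+ 2) < +oo.

Let m_u : measurable_fun [set: X] (u : X -> R) := calV_measurable Vu.

Lemma flux_source_swap v z :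
  flux_source u v z = - flux_target u v (swap z).
Proof. by rewrite /flux_source /flux_target /= -mulNr opprB. Qed.

Lemma energy_densityE v z :
  energy_density u v z = flux_source u v z - flux_target u v z.
Proof. by rewrite /energy_density mulrBr EFinB. Qed.

Let m_source v : calV lambda K Omega v -> measurable_fun setT (flux_source u v).
Proof.
move=> Vv; rewrite /flux_source; apply/measurable_EFinP.
apply: measurable_funM; first exact: measurable_difference.
by apply: measurableT_comp => //; exact: calV_measurable.
Qed.

Let m_target v : calV lambda K Omega v -> measurable_fun setT (flux_target u v).
Proof.
move=> Vv; rewrite /flux_target; apply/measurable_EFinP.
apply: measurable_funM; first exact: measurable_difference.
by apply: measurableT_comp => //; exact: calV_measurable.
Qed.

Let m_energy v : calV lambda K Omega v -> measurable_fun setT (energy_density u v).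
Proof.
move=> Vv; rewrite /energy_density; apply/measurable_EFinP.
by apply: measurable_funM; apply: measurable_difference => //; exact: calV_measurable.
Qed.

Section integrability.
Variable v : 'rV[R]_d -> R.
Hypothesis Vv : calV lambda K Omega v.

Let mv : measurable_fun [set: X] (v : X -> R) := calV_measurable Vv.

(** This is where the regularity of [u] enters: integrating in [y] leaves
    [G x * |v x| <= (G x)^2 + (v x)^2] with
    [G x = \int |u x - u y| K(x, dy)]. *)
Lemma integrable_flux_source : m.-integrable S (flux_source u v).
Proof.
apply/integrableP; split; first exact: measurable_funTS (m_source Vv).
have mabs : measurable_fun S (fun z => `|flux_source u v z|).
  by apply: measurable_funTS; apply: measurableT_comp => //; exact: m_source.
rewrite (ge0_integral_comp_prodX _ _ mOm measurableT mabs)//.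
have mD : measurable_fun setT (fun z : X * X => (`|u z.1 - u z.2|%R)%:E).
  by apply/measurable_EFinP; apply: measurableT_comp => //; exact: measurable_difference.
have mG : measurable_fun [set: X] (fun x => \int[K x]_y (`|u x - u y|%R)%:E).
  apply: (measurable_ge0_integral_section measurable_nondegenerated_xsection mD).
  by move=> z; rewrite lee_fin.
have mG2 : measurable_fun (Omega : set X)
    (fun x => (\int[K x]_y (`|u x - u y|%R)%:E) ^+ 2).
  by under eq_fun do rewrite expe2; apply: measurable_funTS; exact: emeasurable_funM.
have mv2 : measurable_fun (Omega : set X) (fun x => (v x ^+ 2)%:E).
  by apply: measurable_funTS; apply/measurable_EFinP; exact: measurable_funX.
have [v2 _] := sqnormV_parts Vv.
apply: (@le_lt_trans _ _ (\int[lambda]_(x in Omega)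
    ((\int[K x]_y (`|u x - u y|%R)%:E) ^+ 2 + (v x ^+ 2)%:E))); last first.
  rewrite ge0_integralD//.
  - exact: lte_add_pinfty.
  - by move=> x _; rewrite expe_ge0// integral_ge0.
  - by move=> x _; rewrite lee_fin sqr_ge0.
apply: ge0_le_integral => //.
- by move=> x _; apply: integral_ge0.
- exact: (measurable_ge0_integral_sectionX
    measurable_nondegenerated_xsection mOm measurableT mabs).
- by apply: emeasurable_funD.
move=> x _.
have -> : \int[K x]_y `|flux_source u v (x, y)| =
    (\int[K x]_y (`|u x - u y|%R)%:E) * (`|v x|%R)%:E.
  rewrite -ge0_integralZr//; last first.
    exact: (measurableT_comp mD (pair1_measurable x)).
  by apply: eq_integral => y _; rewrite /flux_source /= normrM EFinM.
apply: le_trans (ge0_mule_le_sqrD _ _) _ => //.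
  by apply: integral_ge0.
by rewrite real_normK ?num_real.
Qed.

Lemma integrable_energy_density : m.-integrable S (energy_density u v).
Proof.
apply: le_integrable (integrableD mS (integrable_sqr_difference Vu)
  (integrable_sqr_difference Vv)) => //.
  exact: measurable_funTS (m_energy Vv).
move=> z _; rewrite /energy_density /= lee_fin [leRHS]ger0_norm ?addr_ge0 ?sqr_ge0//.
exact: norm_mul_le_sqrD.
Qed.

(** The target value of [v] need not be square integrable outside [Omega], so
    there is no direct bound; but the flux tested at the target differs from the
    flux tested at the source by the energy density. *)
Lemma integrable_flux_target : m.-integrable S (flux_target u v).
Proof.
have := integrableB mS integrable_flux_source integrable_energy_density.
apply: eq_integrable => // z _; rewrite energy_densityE.
by rewrite /flux_source /flux_target /= -!EFinB; congr EFin; ring.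
Qed.

Let S_OmC : Omega `*` ~` Omega `<=` S. Proof. by case=> x y []. Qed.

(** The rectangle on which the nonlocal Neumann derivative lives, with [Omega]
    as second factor, is reached by exchanging the variables. *)
Lemma integrable_flux_source_boundary :
  m.-integrable (~` Omega `*` Omega) (flux_source u v).
Proof.
have i2 : m.-integrable (Omega `*` ~` Omega) (flux_target u v).
  exact: (integrableS mS (measurableX mOm mOmC) S_OmC integrable_flux_target).
have := integrableN (integrable_swap comp_prod_symmetric mOm mOmC (m_target Vv) i2).
apply: eq_integrable; first exact: measurableX.
by move=> z _; rewrite flux_source_swap.
Qed.

End integrability.

Section green_identity.
Variable v : 'rV[R]_d -> R.
Hypothesis Vv : calV lambda K Omega v.

(** With [v = 1], integrability of the tested flux says that [u x - u y] itself
    is [K x]-integrable for almost every [x \in Omega]; there the principal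
    value is the Lebesgue integral and the factor [v x] can be moved inside. *)
Lemma opL_mul_off_null : exists N : set X, [/\ measurable N, lambda N = 0 &
  forall x, Omega x -> ~ N x ->
    opL K u x * (v x)%:E = \int[K x]_y flux_source u v (x, y)].
Proof.
have [N [mN N0 iN]] := integrable_section_off_null mOm measurableT
  (integrable_flux_source calV_cst1).
exists N; split => // x Omx Nx.
have ix : (K x).-integrable [set: X] (fun y => (u x - u y)%:E).
  by apply: eq_integrable (iN x Omx Nx) => // y _; rewrite /flux_source /= mulr1.
by rewrite /opL pv_integralE ?subrr// -integralZr.
Qed.

(** As for [opL]: moving a negative factor [v y] inside is wrong where the
    positive and negative parts of [u y - u x] both have infinite integral,
    hence the null set. *)
Lemma opN_mul_off_null : exists N : set X, [/\ measurable N, lambda N = 0 &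
  forall y, (~` Omega) y -> ~ N y ->
    opN K Omega u y * (v y)%:E = \int[K y]_(x in Omega) flux_source u v (y, x)].
Proof.
have [N [mN N0 iN]] := integrable_section_off_null mOmC mOm
  (integrable_flux_source_boundary calV_cst1).
exists N; split => // y Omy Ny.
have iy : (K y).-integrable Omega (fun x => (u y - u x)%:E).
  by apply: eq_integrable (iN y Omy Ny) => // x _; rewrite /flux_source /= mulr1.
by rewrite /opN -integralZr.
Qed.

Let mOmOm : measurable (Omega `*` Omega : set (X * X)).
Proof. exact: measurableX. Qed.

Let mOmOmC : measurable (Omega `*` ~` Omega : set (X * X)).
Proof. exact: measurableX. Qed.

Let subS (A : set X) : Omega `*` A `<=` S.
Proof. by case=> x y []. Qed.

Lemma integral_opL : \int[lambda]_(x in Omega) `|opL K u x * (v x)%:E| < +oo /\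
  \int[lambda]_(x in Omega) (opL K u x * (v x)%:E) =
  \int[m]_(z in S) flux_source u v z.
Proof.
have i1 := integrable_flux_source Vv.
have [N [mN N0 LN]] := opL_mul_off_null.
split.
  rewrite (integral_eq_off_null
    (g := fun x => `|\int[K x]_y flux_source u v (x, y)|) mN N0).
    by case/integrableP : (integrable_integral_section mOm measurableT i1).
  by move=> x Omx Nx; rewrite LN.
rewrite (integral_eq_off_null mN N0 LN).
by rewrite integral_comp_prodX.
Qed.

(** Integrands built from [K y] restricted to [Omega] vanish outside the
    nonlocal boundary, which can thus be enlarged to the complement of [Omega],
    where Fubini's theorem on a rectangle applies. *)
Lemma integral_nlboundary (f : X -> \bar R) :
  (forall y, (~` Omega) y -> K y Omega = 0 -> f y = 0) ->
  \int[lambda]_(y in nlboundary K Omega) f y = \int[lambda]_(y in ~` Omega) f y.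
Proof.
move=> f0; rewrite integral_mkcond [RHS]integral_mkcond.
apply: eq_integral => y _; rewrite !patchE.
case: ifPn => [/[!inE] -[Omy _]|/negP yG]; first by rewrite mem_set.
case: ifPn => // /[!inE] Omy; apply/esym/f0 => //.
apply/eqP/negPn/negP => Ky; apply: yG; rewrite inE; split => //.
by rewrite lt0e Ky measure_ge0.
Qed.

Lemma integral_opN :
  \int[lambda]_(y in nlboundary K Omega) `|opN K Omega u y * (v y)%:E| < +oo /\
  \int[lambda]_(y in nlboundary K Omega) (opN K Omega u y * (v y)%:E) =
  - \int[m]_(z in Omega `*` ~` Omega) flux_target u v z.
Proof.
have i1 := integrable_flux_source_boundary Vv.
have [N [mN N0 NN]] := opN_mul_off_null.
have f0 y : (~` Omega) y -> K y Omega = 0 -> opN K Omega u y = 0.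
  move=> _ Ky0; apply: null_set_integral => //.
  by apply/measurable_EFinP; apply: measurable_funTS; apply: measurable_funB.
split.
  rewrite integral_nlboundary; last by move=> y Oy Ky; rewrite f0// mul0e abse0.
  rewrite (integral_eq_off_null
    (g := fun y => `|\int[K y]_(x in Omega) flux_source u v (y, x)|) mN N0).
    by case/integrableP : (integrable_integral_section mOmC mOm i1).
  by move=> x Omx Nx; rewrite NN.
rewrite integral_nlboundary; last by move=> y Oy Ky; rewrite f0// mul0e.
rewrite (integral_eq_off_null mN N0 NN).
rewrite -(integral_comp_prodX mOmC mOm i1).
rewrite (integral_swap comp_prod_symmetric mOmC mOm (m_source Vv) i1).
have i2 : m.-integrable (Omega `*` ~` Omega) (flux_target u v).
  exact: (integrableS mS mOmOmC (@subS _) (integrable_flux_target Vv)).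
rewrite -integralN; last exact: integrable_add_def.
apply: eq_integral => z _; rewrite flux_source_swap.
by case: z.
Qed.

(** By symmetry the integrals of the two tested fluxes over [Omega * Omega] are
    opposite, so half the energy there is the flux tested at the source; over
    the rest of [S] the latter is the energy plus the flux tested at the
    target. *)
Lemma nonlocal_green_formula :
  \int[m]_(z in S) flux_source u v z =
  bformB lambda K Omega u v +
  \int[m]_(z in Omega `*` ~` Omega) flux_target u v z.
Proof.
have iF A : measurable (A : set X) ->
    [/\ m.-integrable (Omega `*` A) (flux_source u v),
        m.-integrable (Omega `*` A) (flux_target u v) &
        m.-integrable (Omega `*` A) (energy_density u v)].
  move=> mA.
  have mOA : measurable (Omega `*` A : set (X * X)) by exact: measurableX.
  split; apply: (integrableS mS mOA (@subS A)).
  - exact: integrable_flux_source.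
  - exact: integrable_flux_target.
  - exact: integrable_energy_density.
have [i1 i2 i3] := iF _ mOm; have [j1 j2 j3] := iF _ mOmC.
have energyE A : measurable (A : set X) ->
    \int[m]_(z in Omega `*` A) energy_density u v z =
    \int[m]_(z in Omega `*` A) flux_source u v z -
    \int[m]_(z in Omega `*` A) flux_target u v z.
  move=> mA; have [k1 k2 _] := iF _ mA.
  rewrite -integralB//; last exact: measurableX.
  by apply: eq_integral => z _; exact: energy_densityE.
have target_source : \int[m]_(z in Omega `*` Omega) flux_target u v z =
    - \int[m]_(z in Omega `*` Omega) flux_source u v z.
  rewrite (integral_swap comp_prod_symmetric mOm mOm (m_target Vv) i2).
  rewrite -integralN; last exact: integrable_add_def.
  apply: eq_integral => z _; rewrite flux_source_swap oppeK.
  by case: z.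
rewrite /bformB -(integral_comp_prodX mOm mOm i3) -(integral_comp_prodX mOm mOmC j3).
rewrite !energyE// target_source.
have -> : \int[m]_(z in S) flux_source u v z =
    \int[m]_(z in Omega `*` Omega) flux_source u v z +
    \int[m]_(z in Omega `*` ~` Omega) flux_source u v z.
  have -> : S = Omega `*` Omega `|` Omega `*` ~` Omega.
    apply/seteqP; split => [[x y] [/= Omx _]|[x y] [] []//].
    by have [?|?] := pselect (Omega y); [left|right].
  rewrite integral_setU//.
  - exact: measurable_funTS (m_source Vv).
  - by apply/disj_setPS => -[x y] [[_ /= ?] [_ /= ?]].
have := integrable_fin_num mOmOm i1; have := integrable_fin_num mOmOmC j1.
have := integrable_fin_num mOmOmC j2.
move=> /fineK <- /fineK <- /fineK <-.
by rewrite -!(EFinN, EFinD, EFinM); congr EFin; field.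
Qed.

End green_identity.

Lemma bformB_cst1 : bformB lambda K Omega u (cst 1%R) = 0.
Proof.
have I0 (A : set X) : \int[lambda]_(x in Omega) \int[K x]_(y in A)
    ((u x - u y) * (cst 1%R x - cst 1%R y))%:E = 0.
  apply: integral0_eq => x _; apply: integral0_eq => y _.
  by rewrite subrr mulr0.
by rewrite /bformB !I0 mule0 adde0.
Qed.

Lemma integral_opLN : \int[lambda]_(x in Omega) (- opL K u x) =
  - \int[m]_(z in S) flux_source u (cst 1%R) z.
Proof.
have i1 := integrable_flux_source calV_cst1.
have [N [mN N0 LN]] := opL_mul_off_null (cst 1%R).
rewrite (integral_comp_prodX mOm measurableT i1) -integralN; last first.
  by apply: (integrable_add_def mOm);
    exact: (integrable_integral_section mOm measurableT i1).
apply: (integral_eq_off_null mN N0) => x Omx Nx.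
by rewrite -(LN x Omx Nx) mule1.
Qed.

End nonlocal_green.

Theorem theorem3p8 (R : realType) (d : nat)
    (lambda : {measure set (borelRn R d) -> \bar R})
    (Omega : set 'rV[R]_d) (Omega_neq0 : Omega !=set0)
    (Omega_open : open Omega) (Omega_fin : lambda Omega < +oo)
    (K : R.-sigmafker borelRn R d ~> borelRn R d)
    (Knd : nondegenerated K) (Ksym : ksymmetric lambda K)
    (u : 'rV[R]_d -> R) (Vu : calV lambda K Omega u)
    (u_reg : \int[lambda]_(x in Omega)
               ((\int[K x]_y (`|u x - u y|%R)%:E) ^+ 2) < +oo) :
  (forall v : 'rV[R]_d -> R, calV lambda K Omega v ->
     [/\ \int[lambda]_(x in Omega) `|opL K u x * (v x)%:E| < +oo,
         \int[lambda]_(y in nlboundary K Omega)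
           `|opN K Omega u y * (v y)%:E| < +oo &
         \int[lambda]_(x in Omega) (opL K u x * (v x)%:E) =
         bformB lambda K Omega u v -
         \int[lambda]_(y in nlboundary K Omega)
           (opN K Omega u y * (v y)%:E)]) /\
  \int[lambda]_(x in Omega) (- opL K u x) =
  \int[lambda]_(y in nlboundary K Omega) opN K Omega u y.
Proof.
split=> [v Vv|].
  have [Lfin LE] := integral_opL Omega_open Omega_fin Knd Vu u_reg Vv.
  have [Nfin NE] := integral_opN Omega_open Omega_fin Knd Ksym Vu u_reg Vv.
  by split => //; rewrite LE NE oppeK; exact: nonlocal_green_formula.
have V1 := calV_cst1 Omega_open Omega_fin K.
have [_ NE] := integral_opN Omega_open Omega_fin Knd Ksym Vu u_reg V1.
have GE := nonlocal_green_formula Omega_open Knd Ksym Vu u_reg V1.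
rewrite (integral_opLN Omega_open Omega_fin Knd Vu u_reg) GE bformB_cst1 add0e.
by rewrite -NE; apply: eq_integral => y _; rewrite mule1.
Qed.
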